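(* Let $(A,\mu)$ be a Lie algebroid, let $\varepsilon_1,\varepsilon_2,\varepsilon_3\in\{1,-1\}$, and let $(\omega_1,\omega_2,\omega_3)$ be a triplet of non-degenerate $2$-forms on $A$ with inverse bivectors $(\pi_1,\pi_2,\pi_3)$. Then $(\omega_1,\omega_2,\omega_3)$ is an $\boldsymbol{\varepsilon}$-hypersymplectic structure on the Lie algebroid $(A,\mu)$ if and only if $(\mathcal{S}_1,\mathcal{S}_2,\mathcal{S}_3)$ is an $\boldsymbol{\varepsilon}$-hypersymplectic structure on the Courant algebroid $(A\oplus A^*,\mu)$, where $$\mathcal{S}_i=\begin{pmatrix}0&\varepsilon_i\,\pi_i^{\sharp}\\ \omega_i^{\flat}&0\end{pmatrix}:A\oplus A^*\to A\oplus A^*,\qquad i=1,2,3 .$$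
   Context: $A\to M$ is a real vector bundle; $\mu$ denotes a Lie algebroid structure on $A$ with anchor $\rho_A$, bracket $[\cdot,\cdot]_A$, differential $\mathrm{d}$ and Lie derivative $\mathcal{L}$. For $\omega\in\Gamma(\wedge^2A^* )$ and $\pi\in\Gamma(\wedge^2A)$, $\omega^\flat:A\to A^*$, $\langle\omega^\flat X,Y\rangle=\omega(X,Y)$, and $\pi^\sharp:A^*\to A$, $\langle\beta,\pi^\sharp\alpha\rangle=\pi(\alpha,\beta)$; $\pi$ is the inverse of $\omega$ if $\pi^\sharp\circ\omega^\flat=\mathrm{id}_A$. A symplectic form is a non-degenerate $\mathrm{d}$-closed $2$-form on $A$. Indices are in $\mathbb{Z}_3=\{1,2,3\}$ and $\boldsymbol{\varepsilon}=(\varepsilon_1,\varepsilon_2,\varepsilon_3)$. An $\boldsymbol{\varepsilon}$-hypersymplectic structure on a Lie algebroid $(A,\mu)$ is a triplet $(\omega_1,\omega_2,\omega_3)$ of symplectic forms with inverse (Poisson) bivectors $(\pi_1,\pi_2,\pi_3)$ such that $N_i:=\pi_{i-1}^\sharp\circ\omega_{i+1}^\flat$ satisfies $N_i^2=\varepsilon_i\,\mathrm{id}_A$, $i=1,2,3$. $A\oplus A^*$ carries $\langle X+\alpha,Y+\beta\rangle=\alpha(Y)+\beta(X)$. The Courant structure on $A\oplus A^*$ also denoted $\mu$ has anchor $\rho(X+\alpha)=\rho_A(X)$ and Dorfman bracket $[X+\alpha,Y+\beta]=[X,Y]_A+\mathcal{L}_X\beta-i_Y\mathrm{d}\alpha$.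 On a (pre-)Courant algebroid $(E,\langle\cdot,\cdot\rangle,\Theta)$, $\Theta=(\rho,[\cdot,\cdot])$, the deformation by a bundle endomorphism $\mathcal{I}$ of $E$ is $\Theta_{\mathcal{I}}=(\rho\circ\mathcal{I},[\cdot,\cdot]_{\mathcal{I}})$ with $[e,e']_{\mathcal{I}}=[\mathcal{I}e,e']+[e,\mathcal{I}e']-\mathcal{I}[e,e']$, and $\Theta_{\mathcal{I},\mathcal{J}}=(\Theta_{\mathcal{I}})_{\mathcal{J}}$; $c\Theta=(c\rho,c[\cdot,\cdot])$. An $\boldsymbol{\varepsilon}$-hypersymplectic structure on $(E,\Theta)$ is a triplet $(\mathcal{S}_1,\mathcal{S}_2,\mathcal{S}_3)$ of endomorphisms, skew-symmetric with respect to $\langle\cdot,\cdot\rangle$, such that $\mathcal{S}_i^2=\varepsilon_i\,\mathrm{id}_E$; $\mathcal{S}_i\mathcal{S}_j=\varepsilon_1\varepsilon_2\varepsilon_3\,\mathcal{S}_j\mathcal{S}_i$ for $i\neq j$; and $\Theta_{\mathcal{S}_i,\mathcal{S}_i}=\varepsilon_i\Theta$, for $i,j\in\{1,2,3\}$. *)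

(* Defs.v *)
From HB Require Import structures.
From mathcomp Require Import all_boot all_order all_algebra ring.
From mathcomp Require Import all_classical all_reals all_analysis.
Import numFieldNormedType.Exports.
Import Order.TTheory GRing.Theory Num.Theory.

Set Implicit Arguments.
Unset Strict Implicit.
Unset Printing Implicit Defensive.

Local Open Scope classical_set_scope.
Local Open Scope ring_scope.

(** * Smooth functions on open subsets of R^n *)

Section Ck.
Context {R : realType} {V : normedModType R}.
Implicit Types (U : set V) (f g : V -> R).

(* Only used for U open in V = R^n: all iterated directional derivatives of
   order at most k exist and are continuous on U. *)
Fixpoint Ck (k : nat) U f : Prop :=
  (forall x, U x -> {for x, continuous f}) /\
  match k with
  | 0 => True
  | k'.+1 => (forall x v, U x -> derivable f x v) /\
             (forall v, Ck k' U ('D_v f : V -> R))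
  end.

Definition Cinfty U f : Prop := forall k, Ck k U f.

Lemma near_open U x (P : V -> Prop) : open U -> U x ->
  (forall y, U y -> P y) -> \forall y \near x, P y.
Proof. by move=> oU Ux H; apply: filterS H _; exact: open_nbhs_nbhs. Qed.

Lemma near_continuous U x f g : open U -> U x ->
  (forall y, U y -> f y = g y) -> {for x, continuous f} -> {for x, continuous g}.
Proof.
move=> oU Ux fg cf; rewrite /prop_for /continuous_at -(fg _ Ux).
apply: cvg_trans cf; apply: near_eq_cvg; exact: (near_open oU Ux fg).
Qed.

Lemma eq_Ck k U f g : open U -> (forall x, U x -> f x = g x) ->
  Ck k U f -> Ck k U g.
Proof.
move=> oU; elim: k f g => [|k IH] f g fg [cf Hf]; split.
- by move=> x Ux; exact: (near_continuous oU Ux fg (cf x Ux)).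
- by [].
- by move=> x Ux; exact: (near_continuous oU Ux fg (cf x Ux)).
- case: Hf => df Df; split.
    move=> x v Ux; apply: (near_eq_derivable _ (df x v Ux)).
    exact: (near_open oU Ux fg).
  move=> v; apply: (IH ('D_v f : V -> R)) (Df v) => x Ux.
  by apply: near_eq_derive; exact: (near_open oU Ux fg).
Qed.

Lemma CkS k U f : Ck k.+1 U f -> Ck k U f.
Proof.
elim: k f => [|k IH] f [cf [df Df]]; split=> //; split=> // v; exact: IH.
Qed.

Lemma Ck_cst k U (c : R) : Ck k U (cst c).
Proof.
elim: k c => [|k IH] c; split=> //; try by move=> x _; exact: cvg_cst.
split=> [x v _|v]; first exact: derivable_cst.
suff -> : ('D_v (cst c) : V -> R) = cst 0 by exact: IH.
by apply/funext => x; rewrite derive_cst.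
Qed.

Lemma CkD k U f g : open U -> Ck k U f -> Ck k U g -> Ck k U (f \+ g).
Proof.
move=> oU; elim: k f g => [|k IH] f g [cf Hf] [cg Hg]; split=> //.
- by move=> x Ux; apply: cvgD; [exact: cf|exact: cg].
- by move=> x Ux; apply: cvgD; [exact: cf|exact: cg].
case: Hf Hg => [df Df] [dg Dg]; split=> [x v Ux|v].
  by apply: derivableD; [exact: df|exact: dg].
apply: (eq_Ck oU _ (IH _ _ (Df v) (Dg v))) => x Ux /=.
exact: (esym (deriveD (df x v Ux) (dg x v Ux))).
Qed.

Lemma CkM k U f g : open U -> Ck k U f -> Ck k U g -> Ck k U (f \* g).
Proof.
move=> oU; elim: k f g => [|k IH] f g Hf Hg.
  split=> // x Ux; apply: cvgM; [exact: (proj1 Hf)|exact: (proj1 Hg)].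
have [f' g'] := (CkS Hf, CkS Hg).
case: Hf Hg => [cf [df Df]] [cg [dg Dg]]; split.
  by move=> x Ux; apply: cvgM; [exact: cf|exact: cg].
split=> [x v Ux|v].
  by apply: derivableM; [exact: df|exact: dg].
apply: (eq_Ck oU _ (CkD oU (IH _ _ f' (Dg v)) (IH _ _ g' (Df v)))) => x Ux /=.
exact: (esym (deriveM (df x v Ux) (dg x v Ux))).
Qed.

End Ck.

(** * Smooth manifolds *)

Record manifold (R : realType) (n : nat) := Manifold {
  carrier :> topologicalType;
  carrier_hausdorff : hausdorff_space carrier;
  carrier_second_countable : @second_countable carrier;
  chart_index : Type;
  chart_dom : chart_index -> set carrier;
  chart : chart_index -> carrier -> 'rV[R]_n;
  chart_inv : chart_index -> 'rV[R]_n -> carrier;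
  chart_dom_open : forall i, open (chart_dom i);
  chart_cover : forall x, exists i, chart_dom i x;
  chart_im_open : forall i, open (chart i @` chart_dom i);
  chartK : forall i x, chart_dom i x -> chart_inv i (chart i x) = x;
  chart_continuous : forall i x, chart_dom i x -> {for x, continuous (chart i)};
  chart_inv_continuous : forall i y, (chart i @` chart_dom i) y ->
    {for y, continuous (chart_inv i)};
  chart_transition : forall i j (k : 'I_n),
    Cinfty (chart i @` (chart_dom i `&` chart_dom j))
           (fun y => chart j (chart_inv i y) 0 k) }.

Section SmoothFunctions.
Context {R : realType} {n : nat} (M : manifold R n).
Implicit Types (O : set M) (f g : M -> R).

Definition smooth_on O f : Prop :=
  forall i, Cinfty (chart i @` (chart_dom i `&` O)) (f \o chart_inv i).

Lemma chart_open (i : chart_index M) O :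
  open O -> open (chart i @` (chart_dom i `&` O)).
Proof.
move=> oO; rewrite openE => _ [x [dx Ox] <-].
have Vx : (chart i @` chart_dom i) (chart i x) by exists x.
have V_near : nbhs (chart i x) (chart i @` chart_dom i).
  by apply: open_nbhs_nbhs; split; [exact: chart_im_open|].
have O_near : nbhs (chart i x) (chart_inv i @^-1` O).
  apply: (chart_inv_continuous Vx); rewrite chartK//.
  exact: open_nbhs_nbhs.
apply: (filterS _ (filterI V_near O_near)) => _ [[z dz <-]] /=.
by rewrite chartK// => Oz; exists z.
Qed.

Lemma smooth_on_cst O (c : R) : smooth_on O (cst c).
Proof. by move=> i k; exact: Ck_cst. Qed.

Lemma smooth_onD O f g : open O ->
  smooth_on O f -> smooth_on O g -> smooth_on O (f \+ g).
Proof. by move=> oO sf sg i k; exact: (CkD (chart_open oO) (sf i k) (sg i k)). Qed.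

Lemma smooth_onM O f g : open O ->
  smooth_on O f -> smooth_on O g -> smooth_on O (f \* g).
Proof. by move=> oO sf sg i k; exact: (CkM (chart_open oO) (sf i k) (sg i k)). Qed.

Lemma eq_smooth_on O f g : open O -> (forall x, O x -> f x = g x) ->
  smooth_on O f -> smooth_on O g.
Proof.
move=> oO fg sf i k; apply: (eq_Ck (chart_open oO) _ (sf i k)).
by move=> _ [x [dx Ox] <-] /=; rewrite chartK// fg.
Qed.

Lemma smooth_on_sub O O' f : O' `<=` O -> smooth_on O f -> smooth_on O' f.
Proof.
move=> OO sf i k.
have sub : chart i @` (chart_dom i `&` O') `<=` chart i @` (chart_dom i `&` O).
  by move=> _ [x [dx Ox] <-]; exists x => //; split=> //; exact: OO.
elim: k (f \o _) (sf i k) => [|k IH] h [ch Hh].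
  by split=> // x /sub; exact: ch.
split; first by move=> x /sub; exact: ch.
by case: Hh => dh Dh; split=> [x v /sub|v]; [exact: dh|apply: IH; exact: Dh].
Qed.

Definition smooth_pred : {pred M -> R} := fun f => `[< smooth_on setT f >].

Lemma smooth_subring : subring_closed smooth_pred.
Proof.
split=> [|f g|f g].
- by apply/asboolP; exact: smooth_on_cst.
- move=> /asboolP sf /asboolP sg; apply/asboolP.
  have -> : f - g = f \+ (cst (-1) \* g).
    by apply/funext => x /=; rewrite mulN1r.
  apply: smooth_onD sf _; first exact: openT.
  by apply: smooth_onM sg; [exact: openT|exact: smooth_on_cst].
- move=> /asboolP sf /asboolP sg; apply/asboolP.
  by apply: smooth_onM sf sg; exact: openT.
Qed.

HB.instance Definition _ :=
  GRing.isSubringClosed.Build (M -> R) smooth_pred smooth_subring.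

Record smooth_fun := SmoothFun {
  smooth_val :> M -> R; _ : smooth_val \in smooth_pred }.

HB.instance Definition _ := [isSub for smooth_val].
HB.instance Definition _ := [Choice of smooth_fun by <:].
HB.instance Definition _ := 
  GRing.SubChoice_isSubComPzRing.Build (M -> R) smooth_pred smooth_fun smooth_subring.

Lemma smooth_funP (f : smooth_fun) : smooth_on setT f.
Proof. by case: f => f fP /=; exact: (asboolW fP). Qed.

Lemma smooth_cst_subproof (c : R) : (cst c : M -> R) \in smooth_pred.
Proof. by apply/asboolP; exact: smooth_on_cst. Qed.

Definition smooth_cst (c : R) : smooth_fun := SmoothFun (smooth_cst_subproof c).

End SmoothFunctions.

Notation "'C^oo' ( M )" := (smooth_fun M) (at level 8, format "'C^oo' ( M )").

Record vector_field (R : realType) (n : nat) (M : manifold R n) := VectorField {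
  derivation :> C^oo(M) -> C^oo(M);
  derivationD : forall f g, derivation (f + g) = derivation f + derivation g;
  derivationZ : forall (c : R) f,
    derivation (smooth_cst M c * f) = smooth_cst M c * derivation f;
  derivationM : forall f g,
    derivation (f * g) = derivation f * g + f * derivation g }.

(** * Vector bundles *)

(* The total space carries the unique topology and smooth structure for which
   the local trivializations are diffeomorphisms, so it is not part of the
   data. *)
Record vector_bundle (R : realType) (n : nat) (M : manifold R n) := VectorBundle {
  fiber :> M -> lmodType R;
  vb_rank : nat;
  triv_index : Type;
  triv_dom : triv_index -> set M;
  triv : triv_index -> forall x, {linear fiber x -> 'rV[R]_vb_rank};
  triv_dom_open : forall i, open (triv_dom i);
  triv_cover : forall x, exists i, triv_dom i x;
  triv_bij : forall i x, triv_dom i x -> bijective (triv i x);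
  triv_transition : forall i j, exists g : M -> 'M[R]_vb_rank,
    (forall k l, smooth_on (triv_dom i `&` triv_dom j) (fun x => g x k l)) /\
    (forall x (v : fiber x), triv_dom i x -> triv_dom j x ->
       triv j x v = triv i x v *m g x) }.

Section Sections.
Context {R : realType} {n : nat} {M : manifold R n} (A : vector_bundle M).

Definition raw_section := forall x : M, A x.
Implicit Types (s t : raw_section).

HB.instance Definition _ := gen_eqMixin raw_section.
HB.instance Definition _ := gen_choiceMixin raw_section.

Let raw_addA : associative (fun s t x => s x + t x : A x).
Proof. by move=> s t u; apply: functional_extensionality_dep => x; rewrite addrA. Qed.
Let raw_addC : commutative (fun s t x => s x + t x : A x).
Proof. by move=> s t; apply: functional_extensionality_dep => x; rewrite addrC. Qed.
Let raw_add0 : left_id (fun x => 0 : A x) (fun s t x => s x + t x).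
Proof. by move=> s; apply: functional_extensionality_dep => x; rewrite add0r. Qed.
Let raw_addN : left_inverse (fun x => 0 : A x) (fun s x => - s x)
  (fun s t x => s x + t x).
Proof. by move=> s; apply: functional_extensionality_dep => x; rewrite addNr. Qed.

HB.instance Definition _ :=
  GRing.isZmodule.Build raw_section raw_addA raw_addC raw_add0 raw_addN.

Definition raw_scale (f : C^oo(M)) s : raw_section := fun x => f x *: s x.

Let raw_scaleA f g s : raw_scale f (raw_scale g s) = raw_scale (f * g) s.
Proof. by apply: functional_extensionality_dep => x; rewrite /raw_scale scalerA. Qed.
Let raw_scale1 : left_id 1 raw_scale.
Proof. by move=> s; apply: functional_extensionality_dep => x; rewrite /raw_scale scale1r. Qed.
Let raw_scaleDr : right_distributive raw_scale +%R.
Proof. by move=> f s t; apply: functional_extensionality_dep => x; rewrite /raw_scale scalerDr. Qed.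
Let raw_scaleDl s : {morph raw_scale^~ s : f g / f + g}.
Proof. by move=> f g; apply: functional_extensionality_dep => x; rewrite /raw_scale scalerDl. Qed.

HB.instance Definition _ := GRing.Zmodule_isLmodule.Build C^oo(M) raw_section
  raw_scaleA raw_scale1 raw_scaleDr raw_scaleDl.

Definition smooth_section_pred : {pred raw_section} := fun s =>
  `[< forall i k, smooth_on (triv_dom i) (fun x => triv i x (s x) 0 k) >].

Lemma smooth_section_submod : submod_closed smooth_section_pred.
Proof.
split.
  apply/asboolP => i k; have -> : (fun x => triv i x ((0 : raw_section) x) 0 k) = cst 0.
    by apply/funext => x; rewrite linear0 mxE.
  exact: smooth_on_cst.
move=> f s t /asboolP ss /asboolP st; apply/asboolP => i k.
have -> : (fun x => triv i x ((f *: s + t : raw_section) x) 0 k) =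
    (f \* (fun x => triv i x (s x) 0 k)) \+ (fun x => triv i x (t x) 0 k).
  by apply/funext => x /=; rewrite linearP !mxE.
apply: smooth_onD (st i k); first exact: triv_dom_open.
apply: smooth_onM (ss i k); first exact: triv_dom_open.
exact: (smooth_on_sub _ (smooth_funP f)).
Qed.

HB.instance Definition _ := GRing.isSubmodClosed.Build C^oo(M) raw_section
  smooth_section_pred smooth_section_submod.

Record smooth_section := SmoothSection {
  section_val :> raw_section; _ : section_val \in smooth_section_pred }.

HB.instance Definition _ := [isSub for section_val].
HB.instance Definition _ := [Choice of smooth_section by <:].
HB.instance Definition _ := [SubChoice_isSubLmodule of smooth_section by <:].

End Sections.

Notation "'Gamma' ( A )" := (smooth_section A) (at level 8, format "'Gamma' ( A )").

(** * Duals and alternating forms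

    Tensor fields on a vector bundle A -> M and bundle maps are represented by
    the corresponding C^oo(M)-multilinear maps on sections. For V = Gamma(A),
    [dual V] is Gamma(A^* ), [alt2 V] is Gamma(wedge^2 A^* ), [bivector V] is
    Gamma(wedge^2 A), and C^oo(M)-linear maps between such modules are the
    bundle maps over the identity of M. *)

Section Dual.
Context {C : comPzRingType} (V : lmodType C).

Definition linear_pred : {pred V -> C^o} := fun a => `[< linear a >].

Lemma linear_submod : submod_closed linear_pred.
Proof.
split.
  by apply/asboolP => c x y; rewrite -[0 _]/(0 : C^o) scaler0 addr0.
move=> c a b /asboolP la /asboolP lb; apply/asboolP => d x y.
rewrite -[LHS]/(c *: a (d *: x + y) + b (d *: x + y)) la lb.
rewrite -[(c *: a + b) x]/(c *: a x + b x) -[(c *: a + b) y]/(c *: a y + b y).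
by rewrite !scalerDr !scalerA [d * c]mulrC addrACA.
Qed.

HB.instance Definition _ := GRing.isSubmodClosed.Build C (V -> C^o)
  linear_pred linear_submod.

Record dual := Dual { dual_val :> V -> C^o; _ : dual_val \in linear_pred }.

HB.instance Definition _ := [isSub for dual_val].
HB.instance Definition _ := [Choice of dual by <:].
HB.instance Definition _ := [SubChoice_isSubLmodule of dual by <:].

Definition mk_dual (a : V -> C^o) (la : linear a) : dual := Dual (asboolT la).

Lemma dual_linear (a : dual) : linear a.
Proof. by case: a => a aP /=; exact: (asboolW aP). Qed.

Record alt2 := Alt2 {
  alt2_val :> V -> V -> C;
  alt2_linearr : forall x, linear (alt2_val x : V -> C^o);
  alt2_linearl : forall y, linear (alt2_val^~ y : V -> C^o);
  alt2_alt : forall x, alt2_val x x = 0 }.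

Definition flat (w : alt2) (x : V) : dual := mk_dual (alt2_linearr w x).

Lemma flat_linear w : linear (flat w).
Proof.
move=> c x y; apply/val_inj/funext => z.
exact: (alt2_linearl w z c x y).
Qed.

HB.instance Definition _ w :=
  GRing.isLinear.Build C V dual _ (flat w) (flat_linear w).

End Dual.

(* The bivector field pi as an alternating form on Gamma(A^* ), together with
   pi^sharp, which exists because Gamma(A) is the C^oo(M)-dual of
   Gamma(A^* ). *)
Record bivector (C : comPzRingType) (V : lmodType C) := Bivector {
  bivector_val :> alt2 (dual V);
  sharp : {linear dual V -> V};
  sharpP : forall a b : dual V, b (sharp a) = bivector_val a b }.

Definition inverse_of (C : comPzRingType) (V : lmodType C)
  (p : bivector V) (w : alt2 V) : Prop := forall x, sharp p (flat w x) = x.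

(** * Lie algebroids *)

Record lie_algebroid (R : realType) (n : nat) (M : manifold R n)
    (A : vector_bundle M) := LieAlgebroid {
  anchor : Gamma(A) -> vector_field M;
  bracket : Gamma(A) -> Gamma(A) -> Gamma(A);
  anchor_linear : forall f X Y g,
    anchor (f *: X + Y) g = f * anchor X g + anchor Y g;
  bracket_linear : forall X (c : R) Y Z,
    bracket X (smooth_cst M c *: Y + Z) =
      smooth_cst M c *: bracket X Y + bracket X Z;
  bracket_anti : forall X Y, bracket X Y = - bracket Y X;
  jacobi : forall X Y Z, bracket X (bracket Y Z) =
    bracket (bracket X Y) Z + bracket Y (bracket X Z);
  anchor_bracket : forall X Y f,
    anchor (bracket X Y) f = anchor X (anchor Y f) - anchor Y (anchor X f);
  leibniz : forall X f Y,
    bracket X (f *: Y) = f *: bracket X Y + anchor X f *: Y }.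

Section LieAlgebroidCalculus.
Context {R : realType} {n : nat} {M : manifold R n} {A : vector_bundle M}.
Variable mu : lie_algebroid A.
Local Notation rho := (anchor mu).
Local Notation br := (bracket mu).
Implicit Types (X Y Z : Gamma(A)) (a b : dual Gamma(A)) (w : alt2 Gamma(A)).

Lemma bracketZl f X Y : br (f *: X) Y = f *: br X Y - rho Y f *: X.
Proof. by rewrite bracket_anti leibniz opprD -scalerN -bracket_anti. Qed.

Lemma bracketDr X Y Z : br X (Y + Z) = br X Y + br X Z.
Proof.
have := bracket_linear mu X 1 Y Z.
have -> : smooth_cst M 1 = 1 by apply/val_inj.
by rewrite !scale1r.
Qed.

Lemma bracketDl X Y Z : br (X + Y) Z = br X Z + br Y Z.
Proof. by rewrite bracket_anti bracketDr opprD -!bracket_anti. Qed.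

Lemma dualD a X Y : a (X + Y) = a X + a Y.
Proof. by have := dual_linear a 1 X Y; rewrite !scale1r. Qed.

Lemma dual0 a : a 0 = 0.
Proof. by apply: (addrI (a 0)); rewrite -dualD !addr0. Qed.

Lemma dualZ a f X : a (f *: X) = f * a X.
Proof. by have := dual_linear a f X 0; rewrite dual0 !addr0. Qed.

Lemma dualN a X : a (- X) = - a X.
Proof. by apply: (addrI (a X)); rewrite -dualD !subrr dual0. Qed.

Lemma anchorD X Y f : rho (X + Y) f = rho X f + rho Y f.
Proof. by have := anchor_linear mu 1 X Y f; rewrite scale1r mul1r. Qed.

Lemma anchorZ g X f : rho (g *: X) f = g * rho X f.
Proof.
have r0 : rho 0 f = 0.
  by apply: (addrI (rho 0 f)); rewrite -anchorD !addr0.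
by have := anchor_linear mu g X 0 f; rewrite r0 !addr0.
Qed.

Definition lie_fun X a Y : C^oo(M) := rho X (a Y) - a (br X Y).

Lemma lie_linear X a : linear (lie_fun X a : Gamma(A) -> C^oo(M)^o).
Proof.
move=> f Y Z; rewrite /lie_fun dualD dualZ bracketDr leibniz !dualD !dualZ.
rewrite derivationD derivationM -[f *: _]/(f * _); ring.
Qed.

Definition lie X a : dual Gamma(A) := mk_dual (@lie_linear X a).

Definition d1_fun a X Y : C^oo(M) := rho X (a Y) - rho Y (a X) - a (br X Y).

Lemma d1_linearr a X : linear (d1_fun a X : Gamma(A) -> C^oo(M)^o).
Proof.
move=> f Y Z; rewrite /d1_fun dualD dualZ bracketDr leibniz !dualD !dualZ.
rewrite derivationD derivationM anchorD anchorZ -[f *: _]/(f * _); ring.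
Qed.

Lemma d1_linearl a Y : linear ((d1_fun a)^~ Y : Gamma(A) -> C^oo(M)^o).
Proof.
move=> f X Z; rewrite /d1_fun dualD dualZ bracketDl bracketZl.
rewrite !dualD dualN !dualZ derivationD derivationM anchorD anchorZ.
rewrite -[f *: _]/(f * _); ring.
Qed.

Lemma bracketxx X : br X X = 0.
Proof.
have two : br X X *+ 2 = 0 by rewrite mulr2n {1}bracket_anti addNr.
have half : smooth_cst M 2^-1 *: (br X X *+ 2) = br X X.
  rewrite -scalerMnr scalerMnl -[RHS]scale1r; congr (_ *: _).
  apply/val_inj/funext => x; rewrite mulr2n.
  by rewrite -[LHS]/(2^-1 + 2^-1 : R) -[RHS]/(1 : R) [RHS]splitr mul1r.
by rewrite -half two scaler0.
Qed.

Lemma d1_alt a X : d1_fun a X X = 0.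
Proof. by rewrite /d1_fun bracketxx dual0 subrr subr0. Qed.

Definition d1 a : alt2 Gamma(A) :=
  Alt2 (d1_linearr a) (d1_linearl a) (d1_alt a).

Definition d2 w X Y Z : C^oo(M) :=
  rho X (w Y Z) - rho Y (w X Z) + rho Z (w X Y)
  - w (br X Y) Z + w (br X Z) Y - w (br Y Z) X.

Definition closed_form w : Prop := forall X Y Z, d2 w X Y Z = 0.

(* Fibrewise: the value at x of a section X lies in the kernel of w_x only if
   it vanishes. *)
Definition nondegenerate_form w : Prop :=
  forall (x : M) X, (forall Y, (w X Y : C^oo(M)) x = 0) ->
    section_val X x = 0.

Definition symplectic w : Prop := nondegenerate_form w /\ closed_form w.

End LieAlgebroidCalculus.

(* The indices live in Z/3, where 3 = 0, so that i - 1 and i + 1 are cyclic. *)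
Definition transition (C : comPzRingType) (V : lmodType C)
    (w : 'Z_3 -> alt2 V) (p : 'Z_3 -> bivector V) (i : 'Z_3) (X : V) : V :=
  sharp (p (i - 1)) (flat (w (i + 1)) X).

Definition hypersymplectic (R : realType) (n : nat) (M : manifold R n)
    (A : vector_bundle M) (mu : lie_algebroid A) (eps : 'Z_3 -> int)
    (w : 'Z_3 -> alt2 Gamma(A)) (p : 'Z_3 -> bivector Gamma(A)) : Prop :=
  [/\ forall i, symplectic mu (w i),
      forall i, inverse_of (p i) (w i) &
      forall i X, transition w p i (transition w p i X) = X *~ eps i].

(** * Courant structures *)

(* A pair (rho, [.,.]) on a module of sections E over C; rho e is an operator
   on functions. *)
Record courant_structure (C : comPzRingType) (E : lmodType C) :=
  CourantStructure {
    canchor : E -> C -> C;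
    dorfman : E -> E -> E }.

Section Courant.
Context {C : comPzRingType} {E : lmodType C}.
Implicit Types (T : courant_structure E) (I : {linear E -> E}).

Definition deform T I : courant_structure E :=
  CourantStructure (fun e => canchor T (I e))
    (fun e e' => dorfman T (I e) e' + dorfman T e (I e') - I (dorfman T e e')).

Definition scale_courant (c : int) T : courant_structure E :=
  CourantStructure (fun e f => canchor T e f *~ c)
    (fun e e' => dorfman T e e' *~ c).

Definition courant_hypersymplectic (pairing : E -> E -> C) T
    (eps : 'Z_3 -> int) (S : 'Z_3 -> {linear E -> E}) : Prop :=
  [/\ forall i e e', pairing (S i e) e' = - pairing e (S i e'),
      forall i e, S i (S i e) = e *~ eps i,
      forall i j e, i != j ->
        S i (S j e) = S j (S i e) *~ (\prod_(k : 'Z_3) eps k) &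
      forall i, deform (deform T (S i)) (S i) = scale_courant (eps i) T].

End Courant.

Section DoubleBundle.
Context {C : comPzRingType} (V : lmodType C).

(* The sections of A (+) A^* when V = Gamma(A). *)
Definition double : lmodType C := (V * dual V)%type.

Definition double_pairing (e e' : double) : C := e.2 e'.1 + e'.2 e.1.

Definition block_fun (c : int) (w : alt2 V) (p : bivector V) (e : double) :
  double := (sharp p e.2 *~ c, flat w e.1).

Lemma block_linear c w p : linear (block_fun c w p).
Proof.
by move=> f e e'; rewrite /block_fun /= !linearP mulrzDl scalerMzr.
Qed.

HB.instance Definition _ c w p :=
  GRing.isLinear.Build C double double _ (block_fun c w p) (block_linear c w p).

Definition block c w p : {linear double -> double} := block_fun c w p.

End DoubleBundle.

Definition double_courant (R : realType) (n : nat) (M : manifold R n)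
    (A : vector_bundle M) (mu : lie_algebroid A) :
    courant_structure (double Gamma(A)) :=
  CourantStructure (fun e => anchor mu e.1 : C^oo(M) -> C^oo(M))
    (fun e e' => (bracket mu e.1 e'.1,
                  lie mu e.1 e'.2 - flat (d1 mu e.2) e'.1)).

(* Main.v *)
(* Skew-symmetry of S_i and S_i^2 = eps_i hold for any non-degenerate w_i. As
   S_i^2 = eps_i, deforming the Dorfman bracket twice by S_i gives
   eps_i [.,.] + 2 T, with T the Nijenhuis torsion of S_i. Writing every element
   of the dual of A as w_i^flat of an element of A, the components of T are combinations
   of the 1-forms i_Y i_X d w_i and their images under pi_i^sharp, so T vanishes
   if and only if w_i is closed. Finally the inverse of N_i is
   pi_(i+1)^sharp w_(i-1)^flat, so N_i^2 = eps_i says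
   pi_(i-1)^sharp w_(i+1)^flat = eps_i pi_(i+1)^sharp w_(i-1)^flat, which is the
   A-component of the commutation relation of S_(i-1) and S_(i+1); the
   dual component is its transpose. *)
Require Import Defs.
From HB Require Import structures.
From mathcomp Require Import all_boot all_order all_algebra ssrAC ring.
From mathcomp Require Import all_classical all_reals all_analysis.

Local Open Scope ring_scope.

Import GRing.Theory Num.Theory.

(** * Integer multiples, alternating forms and musical maps *)

Lemma additive_mulrz {U W : zmodType} (f : U -> W) :
  {morph f : x y / x + y} -> forall x (c : int), f (x *~ c) = f x *~ c.
Proof.
move=> fD; have fB : {morph f : x y / x - y}.
  by move=> x y; apply: (addIr (f y)); rewrite -fD !subrK.
pose F : {additive U -> W} := HB.pack f (GRing.isZmodMorphism.Build U W f fB).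
by move=> x c; exact: (raddfMz F).
Qed.

Section Alternating.
Context {C : comPzRingType} {V : lmodType C}.
Implicit Types (w : alt2 V) (x y : V).

Lemma alt2Dl w x y z : w (x + y) z = w x z + w y z.
Proof. by have := alt2_linearl w z 1 x y; rewrite !scale1r. Qed.

Lemma alt2Dr w x y z : w z (x + y) = w z x + w z y.
Proof. by have := alt2_linearr w z 1 x y; rewrite !scale1r. Qed.

Lemma alt2_anti w x y : w x y = - w y x.
Proof.
have := alt2_alt w (x + y); rewrite alt2Dl !alt2Dr !alt2_alt add0r addr0.
by move/eqP; rewrite addr_eq0 => /eqP.
Qed.

End Alternating.

Section Musical.
Context {C : comPzRingType} {V : lmodType C}.
Implicit Types (w : alt2 V) (p : bivector V) (x y : V) (a b : dual V).

Lemma dual_eq a b : (forall x, a x = b x) -> a = b.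
Proof. by move=> ab; apply/val_inj/funext. Qed.

Lemma dual_mulrz a (c : int) x : (a *~ c) x = a x *~ c.
Proof. exact: (additive_mulrz (fun b : dual V => b x)). Qed.

Lemma dual_apply_mulrz a x (c : int) : a (x *~ c) = a x *~ c.
Proof.
have a0 : a 0 = 0.
  by have := dual_linear a (-1) 0 0; rewrite !scaleN1r oppr0 addr0 addNr.
have := dual_linear a c%:~R x 0; rewrite a0 !addr0 scaler_int => ->.
by rewrite scaler_int.
Qed.

(** Skew-symmetry of [w] and of [p] gives one sign each, and the two cancel. The pair is arbitrary
    because products of maps with different indices are transposed as well. *)
Lemma flat_sharpE w p a x : flat w (sharp p a) x = a (sharp p (flat w x)).
Proof.
by rewrite [LHS](alt2_anti w) -[w x _]/(flat w x _) !sharpP -(alt2_anti p).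
Qed.

(** Transposing the left-inverse identity turns it into a right-inverse identity. *)
Lemma flatK w p : inverse_of p w -> forall a, flat w (sharp p a) = a.
Proof.
by move=> pw a; apply: dual_eq => x; rewrite flat_sharpE pw.
Qed.

Lemma block_skew (c : int) w p (e e' : Defs.double V) :
  double_pairing (block c w p e) e' = - double_pairing e (block c w p e').
Proof.
case: e e' => [x a] [y b]; rewrite /double_pairing /= !dual_apply_mulrz !sharpP.
by rewrite alt2_anti [bivector_val p _ _]alt2_anti mulNrz opprD addrC.
Qed.

Lemma pair_mulrz x a (c : int) : ((x, a) : Defs.double V) *~ c = (x *~ c, a *~ c).
Proof. by rewrite -!scaler_int. Qed.

Lemma block_sqr (c : int) w p (e : Defs.double V) : inverse_of p w ->
  block c w p (block c w p e) = e *~ c.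
Proof.
move=> pw; case: e => [x a].
rewrite /= /block_fun /= pw.
have -> : flat w (sharp p a *~ c) = flat w (sharp p a) *~ c by exact: raddfMz.
by rewrite flatK// pair_mulrz.
Qed.

End Musical.

(** * Twofold deformation and Nijenhuis torsion *)

Section Torsion.
Context {C : comPzRingType} {E : lmodType C}.
Implicit Types (T : courant_structure E) (S : {linear E -> E}).

Definition torsion T S (e e' : E) : E :=
  dorfman T (S e) (S e') - S (dorfman T (S e) e') - S (dorfman T e (S e'))
  + S (S (dorfman T e e')).

Lemma deform2E T S e e' : dorfman (deform (deform T S) S) e e' =
  dorfman T (S (S e)) e' + dorfman T e (S (S e')) - S (S (dorfman T e e'))
  + torsion T S e e' *+ 2.
Proof.
rewrite /torsion /=.
have SB u v : S (u - v) = S u - S v by exact: linearB.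
have SD u v : S (u + v) = S u + S v by exact: linearD.
rewrite SB SD mulr2n !opprD !opprK !addrA.
rewrite [LHS](ACl (1*5*2*3*6*4*7*8*9))%AC/=.
(* The subtracted [S (S (dorfman T e e'))] cancels one of the two copies inside the doubled
   torsion. *)
by rewrite [RHS](ACl (1*2*4*5*6*8*9*10*11*(3*7)))%AC/= addNr addr0.
Qed.

(** As [S] squares to [c], the anchor equation is automatic and the brackets differ by twice the
    torsion. Only integer multiples are moved through the bracket, since a Dorfman bracket need not
    be [C]-bilinear. *)
Lemma deform_sqr_torsion T S (c : int) :
    (forall u v : E, u *+ 2 = v *+ 2 -> u = v) ->
    (forall e e', dorfman T (e *~ c) e' = dorfman T e e' *~ c) ->
    (forall e e', dorfman T e (e' *~ c) = dorfman T e e' *~ c) ->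
    (forall e f, canchor T (e *~ c) f = canchor T e f *~ c) ->
    (forall e, S (S e) = e *~ c) ->
  deform (deform T S) S = scale_courant c T <->
  forall e e', torsion T S e e' = 0.
Proof.
move=> two Tl Tr rl SS.
have defE e e' : dorfman (deform (deform T S) S) e e' =
    dorfman T e e' *~ c + torsion T S e e' *+ 2.
  by rewrite deform2E !SS Tl Tr addrK.
split=> [eqT e e'|tor0].
  apply: two; rewrite mul0rn.
  have := defE e e'; rewrite eqT /=.
  by move/eqP; rewrite -[X in X == _]addr0 => /eqP/addrI.
rewrite /scale_courant.
have -> : (fun e e' => dorfman T e e' *~ c) =
    dorfman (deform (deform T S) S).
  by apply/funext => e; apply/funext => e'; rewrite defE tor0 mul0rn addr0.
have -> : (fun e f => canchor T e f *~ c) =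
    canchor (deform (deform T S) S).
  by apply/funext => e; apply/funext => f; rewrite /= SS rl.
by [].
Qed.

End Torsion.

(** * Torsion of the block maps and closedness *)

Section ClosedTorsion.
Context {R : realType} {n : nat} {M : manifold R n} {A : vector_bundle M}.
Variable mu : lie_algebroid A.
Implicit Types (X Y Z : Gamma(A)) (a b : dual Gamma(A)).
Implicit Types (w : alt2 Gamma(A)) (p : bivector Gamma(A)).

Lemma bracket_mulrzr X Y (c : int) : bracket mu X (Y *~ c) = bracket mu X Y *~ c.
Proof. by apply: additive_mulrz; exact: bracketDr. Qed.

Lemma bracket_mulrzl X Y (c : int) : bracket mu (X *~ c) Y = bracket mu X Y *~ c.
Proof.
by rewrite bracket_anti bracket_mulrzr -mulNrz -bracket_anti.
Qed.

Lemma anchor_mulrz X (c : int) f : anchor mu (X *~ c) f = anchor mu X f *~ c.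
Proof. by rewrite -scaler_int anchorZ mulrzl. Qed.

Lemma lie_mulrz X (c : int) a : lie mu (X *~ c) a = lie mu X a *~ c.
Proof.
apply: dual_eq => Y; rewrite dual_mulrz /= /lie_fun anchor_mulrz.
by rewrite bracket_mulrzl dual_apply_mulrz mulrzBl.
Qed.

Lemma derivation_mulrz (D : vector_field M) f (c : int) : D (f *~ c) = D f *~ c.
Proof. by apply: additive_mulrz; exact: derivationD. Qed.

Lemma lie_mulrzr X a (c : int) : lie mu X (a *~ c) = lie mu X a *~ c.
Proof.
apply: dual_eq => Y; rewrite dual_mulrz /= /lie_fun !dual_mulrz.
by rewrite derivation_mulrz mulrzBl.
Qed.

Lemma d1_mulrz a (c : int) X : flat (d1 mu (a *~ c)) X = flat (d1 mu a) X *~ c.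
Proof.
apply: dual_eq => Y; rewrite dual_mulrz /= /d1_fun !dual_mulrz.
by rewrite !derivation_mulrz !mulrzBl.
Qed.

(* The 1-form [i_Y i_X d w]. *)
Definition d2_flat w X Y : dual Gamma(A) :=
  lie mu X (flat w Y) - flat (d1 mu (flat w X)) Y - flat w (bracket mu X Y).

(** This is Cartan calculus: [i_[X,Y] = L_X i_Y - i_Y L_X] and [L_X = d i_X + i_X d]. The proof
    compares the expanded formulas. *)
Lemma d2_flatE w X Y Z : d2_flat w X Y Z = d2 mu w X Y Z.
Proof.
rewrite -[LHS]/(lie_fun mu X (flat w Y) Z - d1_fun mu (flat w X) Y Z
                - w (bracket mu X Y) Z).
rewrite /lie_fun /d1_fun /d2 /=.
rewrite [w (bracket mu X Z) Y]alt2_anti [w (bracket mu Y Z) X]alt2_anti.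
by ring.
Qed.

Lemma closed_formP w : closed_form mu w <-> forall X Y, d2_flat w X Y = 0.
Proof.
split=> [cl X Y|d0 X Y Z]; first by apply: dual_eq => Z; rewrite d2_flatE cl.
by rewrite -d2_flatE d0.
Qed.

(** On pairs [(X, flat w X')] the block map is the swap of [(X, X')] into [(c X', X)], which leaves
    only additive regrouping. *)
Lemma torsion_block w p (c : int) X X' Y Y' : inverse_of p w ->
  torsion (double_courant mu) (block c w p) (X, flat w X') (Y, flat w Y') =
  (- sharp p (d2_flat w X Y) *~ c - sharp p (d2_flat w X' Y') *~ c *~ c,
   (d2_flat w X' Y + d2_flat w X Y') *~ c).
Proof.
move=> pw.
have pB a b : sharp p (a - b) = sharp p a - sharp p b by exact: linearB.
have pM a m : sharp p (a *~ m) = sharp p a *~ m by exact: raddfMz.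
have fM x m : flat w (x *~ m) = flat w x *~ m by exact: raddfMz.
have gM a x m : flat (d1 mu a) (x *~ m) = flat (d1 mu a) x *~ m by exact: raddfMz.
rewrite /torsion !block_sqr //=.
rewrite /block_fun /= !pw !bracket_mulrzl !bracket_mulrzr !lie_mulrz !gM !fM.
rewrite /d2_flat !pB !pw !pM.
have pairE x y z t a b d e : ((x, a) : Defs.double Gamma(A)) - (y, b) - (z, d)
  + (t, e) = (x - y - z + t, a - b - d + e) by [].
rewrite pair_mulrz pairE.
(* Here [l], [d], [u] are the Lie derivative, differential and bracket terms of [d2_flat w X Y]
   under [sharp p]; the primed letters belong to [X'], [Y']. *)
have sum1 (W : zmodType) (l d l' d' u u' : W) :
    u' *~ c *~ c - (l' *~ c - d) *~ c - (l - d' *~ c) *~ c + u *~ c =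
    - (l - d - u) *~ c - (l' - d' - u') *~ c *~ c.
  rewrite !mulrzBl !mulNrz !mulrzBl !opprD !opprK !addrA.
  by rewrite [LHS](ACl (4*3*6*2*5*1))%AC.
have sum2 (W : zmodType) (l d l' d' u u' : W) :
    l *~ c - d *~ c - u *~ c - u' *~ c + (l' - d') *~ c =
    (l - d' - u + (l' - d - u')) *~ c.
  rewrite !mulrzDl !mulNrz !addrA.
  by rewrite [LHS](ACl (1*6*3*5*2*4))%AC/=.
by rewrite sum1 sum2.
Qed.

(** The constant function 1/2 makes 2 invertible on every module over the smooth functions. *)
Lemma mulr2n_inj {W : lmodType C^oo(M)} (u v : W) : u *+ 2 = v *+ 2 -> u = v.
Proof.
have half (x : W) : smooth_cst M 2^-1 *: (x *+ 2) = x.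
  rewrite -scalerMnr scalerMnl -[RHS]scale1r; congr (_ *: _).
  apply/val_inj/funext => y; rewrite mulr2n.
  by rewrite -[LHS]/(2^-1 + 2^-1 : R) -[RHS]/(1 : R) [RHS]splitr mul1r.
by move=> uv; rewrite -(half u) uv half.
Qed.

Lemma deform_blockP w p (c : int) : c * c = 1 -> inverse_of p w ->
  deform (deform (double_courant mu) (block c w p)) (block c w p) =
    scale_courant c (double_courant mu) <-> closed_form mu w.
Proof.
move=> c2 pw.
have gM a x m : flat (d1 mu a) (x *~ m) = flat (d1 mu a) x *~ m by exact: raddfMz.
rewrite deform_sqr_torsion; first last.
- by move=> e; rewrite block_sqr.
- by move=> [X a] f; rewrite pair_mulrz /= anchor_mulrz.
- move=> [X a] [Y b]; rewrite !pair_mulrz /= bracket_mulrzr lie_mulrzr gM.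
  by rewrite -mulrzBl -pair_mulrz.
- move=> [X a] [Y b]; rewrite !pair_mulrz /= bracket_mulrzl lie_mulrz d1_mulrz.
  by rewrite -mulrzBl -pair_mulrz.
- by move=> u v; exact: mulr2n_inj.
rewrite closed_formP; split=> [tor X Y|d0 [X a] [Y b]]; last first.
  (* Every 1-form is [flat w] of a section, so [torsion_block] covers all arguments. *)
  rewrite -(flatK w p pw a) -(flatK w p pw b) torsion_block// !d0.
  have p0 : sharp p 0 = 0 by exact: linear0.
  by rewrite p0 oppr0 addr0 !mul0rz subr0.
(* Doubling and inserting [c * c = 1] exposes the factor [c] present in the torsion. *)
apply: mulr2n_inj; rewrite mul0rn mulr2n -[LHS]mulr1z -c2 mulrzA.
(* The dual component of this torsion is [2 c i_Y i_X d w]. *)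
have := tor (X, flat w X) (Y, flat w Y); rewrite torsion_block//.
by move=> /(congr1 snd) /= ->; rewrite mul0rz.
Qed.

End ClosedTorsion.

(** * Commutation relations and signs *)

Section Signs.
Context {C : comPzRingType} {V : lmodType C}.
Implicit Types (w : alt2 V) (p : bivector V) (c d : int).

Lemma block_commP w w' p p' c c' d :
    d * d = 1 -> inverse_of p w -> inverse_of p' w' ->
  (forall e, block c w p (block c' w' p' e) = block c' w' p' (block c w p e) *~ d)
  <-> (forall x, sharp p (flat w' x) *~ c = sharp p' (flat w x) *~ c' *~ d).
Proof.
move=> d2 pw pw'.
have fM v x m : flat v (x *~ m) = flat v x *~ m by exact: raddfMz.
split=> [SS x|NN [x a]].
  by have := SS (x, 0); rewrite pair_mulrz => /(congr1 fst).
rewrite /= /block_fun /= pair_mulrz NN !fM; congr (_, _).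
(* After transposition [NN] applies again; the second [d] it brings is absorbed by [d * d = 1]. *)
apply: dual_eq => z; rewrite !dual_mulrz !flat_sharpE -!dual_apply_mulrz NN.
by rewrite -[_ *~ d *~ d]mulrzA d2 mulr1z.
Qed.

Lemma transition_sqrP w w' p p' c : inverse_of p w -> inverse_of p' w' ->
  (forall x, sharp p (flat w' (sharp p (flat w' x))) = x *~ c) <->
  (forall x, sharp p (flat w' x) = sharp p' (flat w x) *~ c).
Proof.
move=> pw pw'.
have fM v x m : flat v (x *~ m) = flat v x *~ m by exact: raddfMz.
have pM q a m : @sharp C V q (a *~ m) = sharp q a *~ m by exact: raddfMz.
split=> NN x.
  (* Applying the inverse map strips one factor from the square. *)
  by have := congr1 (fun y => sharp p' (flat w y)) (NN x);
    rewrite flatK// pw' fM pM.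
by rewrite [X in flat w' X]NN fM pM flatK// pw.
Qed.

End Signs.

(** * Cyclic indices and the equivalence *)

Lemma prod_Z3 (eps : 'Z_3 -> int) i :
  \prod_(k : 'Z_3) eps k = eps (i - 1) * eps i * eps (i + 1).
Proof.
rewrite (reindex_inj (addrI i)) /= !big_ord_recl big_ord0 mulr1.
have -> : lift ord0 (lift ord0 ord0) = -1 :> 'Z_3 by exact: val_inj.
have -> : lift ord0 ord0 = 1 :> 'Z_3 by exact: val_inj.
have -> : ord0 = 0 :> 'Z_3 by exact: val_inj.
by rewrite addr0 mulrA mulrC mulrA.
Qed.

(** Reduces the relations for all distinct indices to those for cyclic neighbours. *)
Lemma Z3_neq (i j : 'Z_3) : i != j -> j = i + 1 \/ i = j + 1.
Proof.
by case: i j => [[|[|[|//]]] ?] [[|[|[|//]]] ?] //= _;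
  first [by left; exact: val_inj|by right; exact: val_inj].
Qed.

Theorem theorem7p2 (R : realType) (n : nat) (M : manifold R n)
    (A : vector_bundle M) (mu : lie_algebroid A) (eps : 'Z_3 -> int)
    (heps : forall i : 'Z_3, eps i = 1 \/ eps i = -1)
    (w : 'Z_3 -> alt2 Gamma(A)) (p : 'Z_3 -> bivector Gamma(A))
    (hw : forall i : 'Z_3, nondegenerate_form (w i))
    (hp : forall i : 'Z_3, inverse_of (p i) (w i)) :
  hypersymplectic mu eps w p <->
  courant_hypersymplectic (@double_pairing _ Gamma(A)) (double_courant mu) eps
    (fun i : 'Z_3 => block (eps i) (w i) (p i)).
Proof.
have eps2 i : eps i * eps i = 1 by case: (heps i) => ->.
have prod2 : (\prod_(k : 'Z_3) eps k) * (\prod_(k : 'Z_3) eps k) = 1.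
  by rewrite -big_split /= big1.
have commP i : (forall X, transition w p i (transition w p i X) = X *~ eps i) <->
    (forall e, block (eps (i - 1)) (w (i - 1)) (p (i - 1))
        (block (eps (i + 1)) (w (i + 1)) (p (i + 1)) e) =
      block (eps (i + 1)) (w (i + 1)) (p (i + 1))
        (block (eps (i - 1)) (w (i - 1)) (p (i - 1)) e)
        *~ \prod_(k : 'Z_3) eps k).
  rewrite block_commP// (transition_sqrP _ _ _ _ _ (hp (i - 1)) (hp (i + 1))).
  (* In the product, [eps (i + 1)] squares to 1 and [eps (i - 1)] cancels from both sides, leaving
     [eps i]. *)
  suff signE (x y : Gamma(A)) : (x = y *~ eps i) <->
      x *~ eps (i - 1) = y *~ eps (i + 1) *~ \prod_(k : 'Z_3) eps k.
    by split=> H x; apply/signE; exact: H.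
  rewrite (prod_Z3 _ i) -mulrzA mulrCA !mulrA -(mulrA _ (eps (i + 1))) eps2 mulr1.
  case: (heps (i - 1)) => ->; first by rewrite mul1r mulr1z.
  by rewrite mulN1r mulrN1z mulrNz; split=> [->|/oppr_inj].
split=> [[sympl _ NN]|[_ _ SS DD]].
  split.
  - by move=> i e e'; exact: block_skew.
  - by move=> i e; exact: block_sqr.
  - move=> i j e ij.
    have succP k : block (eps k) (w k) (p k)
          (block (eps (k + 1 + 1)) (w (k + 1 + 1)) (p (k + 1 + 1)) e) =
        block (eps (k + 1 + 1)) (w (k + 1 + 1)) (p (k + 1 + 1))
          (block (eps k) (w k) (p k) e) *~ \prod_(l : 'Z_3) eps l.
      have /commP/(_ e) := NN (k + 1); rewrite addrK; exact.
    have k2 (k : 'Z_3) : k + 1 + 1 + 1 = k.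
      by rewrite -!addrA [X in _ + X](_ : _ = 0) ?addr0//; exact: val_inj.
    have flip (x y : Defs.double Gamma(A)) :
        x = y *~ (\prod_(k : 'Z_3) eps k) -> y = x *~ (\prod_(k : 'Z_3) eps k).
      by move=> ->; rewrite -mulrzA prod2 mulr1z.
    (* Since [k + 3 = k], [succP] relates [k + 1] to [k] in this order; [flip] gives the opposite
       order. *)
    case: (Z3_neq _ _ ij) => E; subst.
      by have := succP (i + 1); rewrite k2 => /flip.
    by have := succP (j + 1); rewrite k2.
  - by move=> i; apply/deform_blockP => //; case: (sympl i).
split=> //.
- by move=> i; split=> //; apply/(deform_blockP mu _ (p i) (eps i)).
- move=> i; apply/commP => e; apply: SS.
  (* It remains that [i - 1] and [i + 1] differ. *)
  by case: i => [[|[|[|//]]] ?].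
Qed.
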